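(* Let $G$ be a group, let $X$ be a finite dimensional Banach space over $\mathbb{K}\in\{\mathbb{R},\mathbb{C}\}$, and let $W:G\times G\to\mathbb{B}_X$ be a partial cotranslation. Then $\mathrm{rank}\,W(g,h)=\mathrm{rank}\,W(k,\ell)$ for every $g,h,k,\ell\in G$.
   Context: $\mathbb{B}_X$ is the algebra of continuous linear operators $X\to X$. A function $W:G\times G\to\mathbb{B}_X$ is a partial cotranslation if $W(g,kh)=W(hg,k)\circ W(g,h)$ for all $g,h,k\in G$. *)

(* Defs.v *)
From HB Require Import structures.
From mathcomp Require Import all_boot all_order all_algebra.
From mathcomp Require Import all_classical all_reals all_analysis.
From mathcomp Require Import complex.

Set Implicit Arguments.
Unset Strict Implicit.
Unset Printing Implicit Defensive.

Import Order.TTheory GRing.Theory Num.Theory.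
Import numFieldNormedType.Exports.

Local Open Scope ring_scope.

Variant scalar_kind := RealScalars | ComplexScalars.

Definition scalar_field (R : realType) (s : scalar_kind) : numFieldType :=
  match s with
  | RealScalars => R : numFieldType
  | ComplexScalars => R[i] : numFieldType
  end.

(* Both parents extend the same K-module structure on X, so the norm and the
   dimension are compatible by construction. *)
#[short(type="finDimBanachType")]
HB.structure Definition FinDimBanach (K : numFieldType) :=
  {X of CompleteNormedModule K X & Vector K X}.

#[short(type="continuousOperator")]
HB.structure Definition ContinuousOperator (K : numFieldType)
    (X Y : normedModType K) :=
  {f of @Continuous X Y f & @GRing.Linear K X Y *:%R f}.

Definition partial_cotranslation (K : numFieldType) (G : groupType)
    (X : completeNormedModType K) (W : G -> G -> continuousOperator X X) : Prop :=
  forall g h k : G, W g (k * h)%g =1 W (h * g)%g k \o W g h.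

Definition rank (K : numFieldType) (X : finDimBanachType K)
    (f : continuousOperator X X) : nat :=
  \dim (limg (linfun f)).

(* Main.v *)
Require Import Defs.
From mathcomp Require Import all_boot all_order all_algebra.
From mathcomp Require Import all_classical all_reals all_analysis.

(* Write [r(g, h)] for the rank of [W g h]. Every [h'] is of the form [k h], so
   the cotranslation identity factors [W g h'] through [W g h] for arbitrary
   [h, h'], whence [r(g, h)] does not depend on [h]. The other factor gives
   [r(g, k h) <= r(h g, k)], where [h g] is again arbitrary. *)

(** Rank-nullity for [f] restricted to [A]. *)
Lemma dim_limg_le (K : fieldType) (U V : vectType K) (f : 'Hom(U, V))
    (A : {vspace U}) : (\dim (f @: A) <= \dim A)%N.
Proof. by rewrite -(limg_ker_dim f A) leq_addl. Qed.

Section RankComposition.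
Context {K : numFieldType} {X : finDimBanachType K}.
Implicit Types f g h : continuousOperator X X.

(** Carries a pointwise factorization, the form in which the cotranslation identity comes, over to
    ['End(X)], where [rank] is computed. *)
Lemma linfun_comp f g h : f =1 g \o h ->
  linfun f = (linfun g \o linfun h)%VF :> 'End(X).
Proof. by move=> fE; apply/lfunP => x; rewrite comp_lfunE !lfunE /=; exact: fE. Qed.

Lemma rank_comp_le_right f g h : f =1 g \o h -> (rank f <= rank h)%N.
Proof. by rewrite /rank => /linfun_comp ->; rewrite limg_comp dim_limg_le. Qed.

(** The range of [g \o h] is the image under [g] of a subspace, so it lies in the range of [g]. *)
Lemma rank_comp_le_left f g h : f =1 g \o h -> (rank f <= rank g)%N.
Proof.
by rewrite /rank => /linfun_comp ->; rewrite limg_comp dimvS // limgS ?subvf.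
Qed.

End RankComposition.

Theorem proposition5p4 (R : realType) (s : scalar_kind) (G : groupType)
    (X : finDimBanachType (scalar_field R s)) (W : G -> G -> continuousOperator X X) :
  partial_cotranslation W ->
  forall g h k l : G, rank (W g h) = rank (W k l).
Proof.
move=> Wcot.
have le_snd g h h' : (rank (W g h') <= rank (W g h))%N.
  by have /rank_comp_le_right := Wcot g h (h' * h^-1)%g; rewrite mulgVK.
have le_rank g h k l : (rank (W g h) <= rank (W k l))%N.
  (* With second argument [l * (k * g^-1)], the left factor of [W g _] is [W (k * g^-1 * g) l], that
     is [W k l]. *)
  apply: leq_trans (le_snd _ (l * (k * g^-1))%g _) _.
  by have /rank_comp_le_left := Wcot g (k * g^-1)%g l; rewrite mulgVK.
by move=> g h k l; apply/eqP; rewrite eqn_leq !le_rank.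
Qed.
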